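(* Let $X$ be an infinite-dimensional complex Banach space, $\lambda\in\mathbb{C}$, $T\in L(X)$, $d\in\mathbb{N}_0$, and let $T-\lambda I$ have TUD for $n\ge d$. Then the following statements are equivalent: (1) $\sigma_{\Phi_+}(T)$ does not cluster at $\lambda$; (2) $\lambda$ is not an interior point of $\sigma_{\Phi_+}(T)$; (3) $\sigma_{LD}^e(T)$ does not cluster at $\lambda$; (4) $\lambda$ is not an interior point of $\sigma_{LD}^e(T)$; (5) $a_e(T-\lambda I)<\infty$; (6) $T-\lambda I$ is left essentially Drazin invertible.
   Context: $L(X)$ is the algebra of bounded linear operators on $X$; $N(T)$, $R(T)$ are the null space and range; $\mathbb{N}_0=\{0,1,2,\dots\}$. $T$ is upper semi-Fredholm if $\dim N(T)<\infty$ and $R(T)$ is closed; $\sigma_{\Phi_+}(T)$ is the set of $\mu\in\mathbb{C}$ such that $T-\mu I$ is not upper semi-Fredholm. The essential ascent is $a_e(T)=\inf\{n\in\mathbb{N}_0:\dim N(T^{n+1})/N(T^n)<\infty\}$ ($\inf\emptyset=\infty$). $T$ is left essentially Drazin invertible if $a_e(T)<\infty$ and $R(T^{a_e(T)+1})$ is closed; $\sigma_{LD}^e(T)$ is the set of $\mu\in\mathbb{C}$ such that $T-\mu I$ is not left essentially Drazin invertible. Let $k_n(T)=\dim (R(T^n)\cap N(T))/(R(T^{n+1})\cap N(T))$. The operator range topology on $R(T^d)$ is given by the norm $\|y\|_d=\inf\{\|x\|:x\in X,\ y=T^dx\}$. $T$ has topological uniform descent (TUD) for $n\ge d$ if $k_n(T)=0$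 for all $n\ge d$ and $R(T^n)$ is closed in the operator range topology of $R(T^d)$ for all $n\ge d$. A set $K\subset\mathbb{C}$ does not cluster at $\lambda$ if $\lambda$ is not an accumulation point of $K$; interior is taken in $\mathbb{C}$. *)

(* Defs.v *)
From HB Require Import structures.
From mathcomp Require Import all_boot all_order all_algebra.
From mathcomp Require Import complex.
From mathcomp Require Import all_classical all_reals all_analysis.

Set Implicit Arguments.
Unset Strict Implicit.
Unset Printing Implicit Defensive.

Import Order.TTheory GRing.Theory Num.Theory.
Import numFieldNormedType.Exports.

Local Open Scope classical_set_scope.
Local Open Scope ring_scope.

Section Operators.
Context {R : realType} {X : completeNormedModType R[i]}.
Implicit Types (V W : set X) (A T : {linear X -> X}) (mu : R[i]) (n d : nat).

(* dim V/W for subspaces W of V, as an extended real: the supremum of the sizes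
   of the finite families in V that are linearly independent modulo W. *)
Definition free_mod V W n (v : 'I_n -> X) : Prop :=
  (forall i, V (v i)) /\
  (forall c : 'I_n -> R[i], W (\sum_(i < n) c i *: v i) -> forall i, c i = 0).

Definition dim_quot V W : \bar R :=
  ereal_sup [set (n%:R)%:E | n in [set n | exists v : 'I_n -> X, free_mod V W v]].

Definition ldim V : \bar R := dim_quot V [set 0].

Definition null A n : set X := [set x | iter n A x = 0].
Definition ran A n : set X := range (iter n A).

Definition sub_scalar T mu : {linear X -> X} := T \- (mu \*: idfun).

Definition upper_semi_fredholm A : Prop :=
  (ldim (null A 1) < +oo)%E /\ closed (ran A 1).

(* [ereal_inf set0 = +oo] *)
Definition ess_ascent A : \bar R :=
  ereal_inf [set (n%:R)%:E | n in
    [set n | (dim_quot (null A n.+1) (null A n) < +oo)%E]].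

(* [ess_ascent A] is [+oo] or a natural number, so the existence of [n]
   expresses [ess_ascent A < +oo] and names its value. *)
Definition left_ess_drazin_invertible A : Prop :=
  exists n : nat, ess_ascent A = (n%:R)%:E /\ closed (ran A n.+1).

(* R[i]^o is R[i] as a normed space over itself, which carries the usual
   topology of the complex plane. *)
Definition sigma_usf T : set R[i]^o :=
  [set mu | ~ upper_semi_fredholm (sub_scalar T mu)].
Definition sigma_led T : set R[i]^o :=
  [set mu | ~ left_ess_drazin_invertible (sub_scalar T mu)].

Definition k_ A n : \bar R :=
  dim_quot (ran A n `&` null A 1) (ran A n.+1 `&` null A 1).

(* Norms in X take values in R[i], and are real there. *)
Definition ran_norm A d (y : X) : R :=
  inf [set complex.Re `|x| | x in [set x | y = iter d A x]].

Definition ran_ball A d (y : X) (e : R) : set X :=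
  [set z | ran A d z /\ ran_norm A d (y - z) < e].

Definition ran_closure A d V : set X :=
  [set y | ran A d y /\ forall e : R, 0 < e -> V `&` ran_ball A d y e !=set0].

(* V, a subset of R(A^d), is closed in the operator range topology. *)
Definition ran_closed A d V : Prop := ran_closure A d V `<=` V.

Definition has_TUD A d : Prop :=
  (forall n, (d <= n)%N -> k_ A n = 0%E) /\
  (forall n, (d <= n)%N -> ran_closed A d (ran A n)).

End Operators.

(* Main.v *)
Require Import Defs.
From HB Require Import structures.
From mathcomp Require Import all_boot all_order all_algebra.
From mathcomp Require Import complex.
From mathcomp Require Import all_classical all_reals all_analysis.
From mathcomp Require Import ring lra.
Set Implicit Arguments.
Unset Strict Implicit.
Unset Printing Implicit Defensive.
Import Order.TTheory GRing.Theory Num.Theory.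
Import numFieldNormedType.Exports.
Local Open Scope classical_set_scope.
Local Open Scope ring_scope.

(** Put A = T - lambda and N = N(A^d). Everything takes place in the Banach
space X / N, without ever forming it: all operators, ranges and dimensions are
read modulo the closed subspace N. Since X / N is isomorphic to R(A^d) with its
operator range topology, uniform descent for n >= d says precisely that the
operator induced by A on X / N is semi-regular: the subspaces R(A^k) + N are
closed ([TUD_closed]), and whatever A sends into N lies in all of them
([TUD_kernel_mod]).

Semi-regularity survives small perturbations. The open mapping theorem
([open_mapping]) provides a constant C such that every y in R(A) + N is A x
modulo N with |x| <= C |y|. The hyper-range E, the intersection of all
R(A^k) + N, is closed and A lifts elements of E to elements of E; so a
geometric series ([iterate_solve]) shows that A - mu maps E onto E modulo N
as soon as C |mu| is small ([hyper_range_solve]). As the kernel of A modulo N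
is contained in E, each of its elements x can be corrected by an element of
norm at most |x| / 8 into the kernel of A - mu modulo N, and conversely
([kernel_near_perturbed], [perturbed_near_kernel]). The same correction keeps
the range of A - mu closed modulo N ([closed_range_perturbed]).

Closeness in this one-sided sense carries over finiteness of dimension: if every vector of V is within |x| / 8 of a vector of W and W / N is
finite-dimensional, then so is V / N ([finite_dim_near]; Riesz's lemma would
otherwise yield too many separated vectors near a totally bounded set). For
mu <> 0 the operator A - mu is invertible on N, which turns statements modulo N
into plain ones. Hence [punctured_neighbourhood]: for all small mu <> 0,
R(A - mu) is closed, dim N(A - mu) is finite if N(A^(d+1)) / N(A^d) is
finite-dimensional, and N(A^(d+1)) / N(A^d) is finite-dimensional if some
N((A - mu)^(n+1)) / N((A - mu)^n) is.

The last clause shows that lambda has finite essential ascent as soon as it is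
not interior to the left essentially Drazin spectrum; the first two show that
finite essential ascent at lambda makes T - mu upper semi-Fredholm for all mu
near lambda, mu <> lambda. As upper semi-Fredholm operators are left
essentially Drazin invertible and the complex plane has no isolated points,
five of the six conditions are linked. What remains is that finite essential
ascent p forces R(A^(p+1)) to be closed: R(A^(p+1)) + N(A^d) is closed and
R(A^(p+1)) meets N(A^d) in a finite-dimensional, hence closed, subspace, and an
operator range whose sum and intersection with a closed subspace are closed is
itself closed ([closed_ran_cap_null], [closed_ran]). *)

(** * Real-valued norms *)

Section RealNorm.
Context {R : realType}.
Implicit Types (V : normedZmodType R[i]) (c : R[i]).

(** The norms at hand are nonnegative real elements of R[i]. Working with their
real part makes them live in the ordered field R, where linear arithmetic
applies. *)
Definition rnorm {V : normedZmodType R[i]} (x : V) : R := complex.Re `|x|.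

Lemma normE V (x : V) : `|x| = ((rnorm x)%:C)%C.
Proof. by rewrite /rnorm RRe_real // normr_real. Qed.

Lemma rnorm_ge0 V (x : V) : 0 <= rnorm x.
Proof. by rewrite -lecR -normE normr_ge0. Qed.

Lemma rnorm0 V : rnorm (0 : V) = 0.
Proof. by rewrite /rnorm normr0. Qed.

Lemma rnormN V (x : V) : rnorm (- x) = rnorm x.
Proof. by rewrite /rnorm normrN. Qed.

Lemma rnormB V (x y : V) : rnorm (x - y) = rnorm (y - x).
Proof. by rewrite -rnormN opprB. Qed.

Lemma rnormD_le V (x y : V) : rnorm (x + y) <= rnorm x + rnorm y.
Proof. by rewrite -lecR rmorphD /= -!normE ler_normD. Qed.

Lemma rnormB_le V (x y : V) : rnorm (x - y) <= rnorm x + rnorm y.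
Proof. by apply: le_trans (rnormD_le _ _) _; rewrite rnormN. Qed.

Lemma rnorm_tri V (z x y : V) : rnorm (x - y) <= rnorm (x - z) + rnorm (z - y).
Proof. by have := rnormD_le (x - z) (z - y); rewrite addrA subrK. Qed.

Lemma rnorm0_eq0 V (x : V) : rnorm x = 0 -> x = 0.
Proof. by move=> x0; apply/normr0_eq0; rewrite normE x0. Qed.

Lemma rnorm_gt0 V (x : V) : x != 0 -> 0 < rnorm x.
Proof.
move=> x0; rewrite lt_neqAle rnorm_ge0 andbT eq_sym.
by apply: contraNN x0 => /eqP/rnorm0_eq0 ->.
Qed.

Lemma rnormZ (V : normedModType R[i]) c (x : V) :
  rnorm (c *: x) = rnorm c * rnorm x.
Proof.
by apply: complexI; rewrite rmorphM /= -!normE normrZ.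
Qed.

Lemma rnormM c c' : rnorm (c * c') = rnorm c * rnorm c'.
Proof. by apply: complexI; rewrite rmorphM /= -!normE normrM. Qed.

Lemma rnormC (a : R) : rnorm (a%:C)%C = `|a|.
Proof. by rewrite /rnorm normc_def /= expr0n /= addr0 sqrtr_sqr. Qed.

Lemma rnormi : rnorm ('i : R[i])%C = 1.
Proof. by rewrite /rnorm normc_def /= expr0n /= add0r expr1n sqrtr1. Qed.

Lemma rnormV c : rnorm c^-1 = (rnorm c)^-1.
Proof.
by apply: complexI; rewrite /= fmorphV -!normE normfV.
Qed.

Lemma Re_le c : `|complex.Re c| <= rnorm c.
Proof. by rewrite -lecR -normE normc_ge_Re. Qed.

Lemma Im_le c : `|complex.Im c| <= rnorm c.
Proof.
have := Re_le (c * - 'i)%C; rewrite rnormM rnormN rnormi mulr1.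
by case: c => a b /=; rewrite oppr0 mulr0 sub0r mulrN1 opprK.
Qed.

End RealNorm.

(** * Limits and bounded operators *)

Section Banach.
Context {R : realType}.
Implicit Types X : completeNormedModType R[i].

Lemma nbhs_rnorm (V : normedModType R[i]) (x : V) (U : set V) :
  nbhs x U <-> exists2 e : R, 0 < e & forall y, rnorm (x - y) < e -> U y.
Proof.
split=> [/nbhs_ballP|].
- move=> [e /= e0 eU]; have eE : ((complex.Re e)%:C)%C = e.
    by rewrite RRe_real // gtr0_real.
  exists (complex.Re e); first by rewrite -ltcR eE.
  by move=> y xy; apply: eU; rewrite -ball_normE /= normE -eE ltcR.
- move=> [e e0 eU]; apply/nbhs_ballP; exists (e%:C)%C => /=; first by rewrite ltcR.
  by move=> y; rewrite -ball_normE /= normE ltcR; apply: eU.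
Qed.

Definition adherent X (V : set X) (x : X) :=
  forall e : R, 0 < e -> exists2 v, V v & rnorm (x - v) < e.

Lemma closed_adherent X (V : set X) :
  closed V <-> (forall x, adherent V x -> V x).
Proof.
split=> cV x Vx; apply: cV.
- move=> U /nbhs_rnorm [e e0 eU]; have [v Vv xv] := Vx e e0.
  by exists v; split=> //; apply: eU.
- move=> e e0; have [] := Vx (fun y => rnorm (x - y) < e).
    by apply/nbhs_rnorm; exists e.
  by move=> v [Vv xv]; exists v.
Qed.

Lemma geometric_small (M q e : R) : 0 <= q < 1 -> 0 < e ->
  exists k, M * q ^+ k < e.
Proof.
move=> /andP[q0 q1] e0.
have : (fun k => M * q ^+ k) @ \oo --> M * 0.
  by apply: cvgMr; apply: cvg_expr; rewrite ger0_norm.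
rewrite mulr0 => /cvgrPdist_lt/(_ e e0) [k _ /(_ k (leqnn k))] /=.
by rewrite sub0r normrN => /(le_lt_trans (ler_norm _)); exists k.
Qed.

(** The rate of convergence is part of the conclusion because operators are applied
to the limit afterwards, with control on the size of its image. *)
Lemma geometric_lim X (u : nat -> X) (M q : R) : 0 <= q < 1 ->
  (forall k, rnorm (u k.+1 - u k) <= M * q ^+ k) ->
  exists l, forall k, rnorm (u k - l) <= M * q ^+ k / (1 - q).
Proof.
move=> qP uM; have /andP[q0 q1] := qP.
have M0 : 0 <= M by have := le_trans (rnorm_ge0 _) (uM 0%N); rewrite expr0 mulr1.
have q1' : 0 < 1 - q by rewrite subr_gt0.
have tail k m : rnorm (u (k + m)%N - u k) <= M * q ^+ k / (1 - q).
  suff : rnorm (u (k + m)%N - u k) <= M * q ^+ k * (1 - q ^+ m) / (1 - q).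
    move=> /le_trans; apply; rewrite ler_wpM2r ?invr_ge0 ?(ltW q1')//.
    by rewrite ler_piMr ?mulr_ge0 ?exprn_ge0// gerBl exprn_ge0.
  elim: m => [|m IH]; first by rewrite addn0 subrr rnorm0 expr0 subrr mulr0 mul0r.
  rewrite addnS; apply: le_trans (rnorm_tri (u (k + m)%N) _ _) _.
  apply: le_trans (lerD (uM _) IH) _; rewrite exprD exprS le_eqVlt; apply/orP; left.
  by apply/eqP; field; rewrite gt_eqF.
have : cvg (u @ \oo).
  apply: cauchy_cvg; apply: cauchy_exP => e e0.
  have eE : ((complex.Re e)%:C)%C = e by rewrite RRe_real // gtr0_real.
  have [|k ke] := geometric_small (M / (1 - q)) qP (e := complex.Re e).
    by rewrite -ltcR eE.
  exists (u k); exists k => // m /= km.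
  rewrite -ball_normE /= normE -eE ltcR rnormB -(subnKC km).
  by apply: le_lt_trans (tail _ _) _; rewrite mulrAC.
move=> cu; exists (lim (u @ \oo)) => k.
apply/ler_addgt0Pr => e e0.
have [m _ mP] : \forall m \near \oo, rnorm (lim (u @ \oo) - u m) < e.
  apply: (cu [set y | rnorm (lim (u @ \oo) - y) < e]).
  by apply/nbhs_rnorm; exists e.
have := mP (k + m)%N (leq_addl _ _) => h.
apply: le_trans (rnorm_tri (u (k + m)%N) _ _) _.
by apply: lerD; rewrite rnormB; [exact: tail | exact: ltW].
Qed.

Definition bounded_op X (f : X -> X) :=
  exists2 K : R, 0 <= K & forall x, rnorm (f x) <= K * rnorm x.

Lemma bounded_op_bounded_near X (f : {linear X -> X}) :
  bounded_near f (nbhs (0 : X)) -> bounded_op f.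
Proof.
move=> /linear_boundedP/pinfty_ex_gt0 [r r0 rf].
have rE : ((complex.Re r)%:C)%C = r by rewrite RRe_real // gtr0_real.
exists (complex.Re r); first by rewrite -lecR rE ltW.
by move=> x; rewrite -lecR rmorphM /= rE -!normE.
Qed.

End Banach.

(** * Subspaces and solving equations by successive approximation *)

Section Subspaces.
Context {R : realType} {X : completeNormedModType R[i]}.
Implicit Types (V W N E : set X) (x y z : X) (B : {linear X -> X}).

Definition is_subspace V := V 0 /\ forall (c : R[i]) x y, V x -> V y -> V (c *: x + y).

Lemma subspace0 V : is_subspace V -> V 0. Proof. by case. Qed.

Lemma subspaceZ V (c : R[i]) x : is_subspace V -> V x -> V (c *: x).
Proof. by move=> [V0 VD] Vx; rewrite -[_ *: _]addr0; apply: VD. Qed.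

Lemma subspaceD V x y : is_subspace V -> V x -> V y -> V (x + y).
Proof. by move=> [V0 VD] Vx Vy; rewrite -[x]scale1r; apply: VD. Qed.

Lemma subspaceN V x : is_subspace V -> V x -> V (- x).
Proof. by move=> sV Vx; rewrite -scaleN1r; apply: subspaceZ. Qed.

Lemma subspaceB V x y : is_subspace V -> V x -> V y -> V (x - y).
Proof. by move=> sV Vx Vy; apply: subspaceD => //; apply: subspaceN. Qed.

Lemma subspace_sum V n (F : 'I_n -> X) : is_subspace V ->
  (forall i, V (F i)) -> V (\sum_i F i).
Proof.
move=> sV VF; elim/big_ind : _ => //; first exact: subspace0.
by move=> x y; apply: subspaceD.
Qed.

Lemma subspaceI V W : is_subspace V -> is_subspace W -> is_subspace (V `&` W).
Proof.
move=> [V0 VD] [W0 WD]; split=> // c x y [Vx Wx] [Vy Wy].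
by split; [apply: VD | apply: WD].
Qed.

Lemma subspaceT : is_subspace [set: X]. Proof. by []. Qed.

Lemma subspace_set0 : is_subspace [set 0].
Proof. by split=> // c x y -> ->; rewrite /= scaler0 addr0. Qed.

Lemma subspace_preimage B V : is_subspace V -> is_subspace (B @^-1` V).
Proof.
move=> [V0 VD]; split=> [|c x y Vx Vy] /=; first by rewrite linear0.
by rewrite linearP; apply: VD.
Qed.

Lemma closed_preimage B V : bounded_op B -> closed V -> closed (B @^-1` V).
Proof.
move=> [K K0 BK] /closed_adherent cV; apply/closed_adherent => x xV /=.
apply: cV => e e0; have K1 : 0 < K + 1 by rewrite ltr_wpDl.
have [v Vv xv] := xV (e / (K + 1)) (divr_gt0 e0 K1).
exists (B v) => //; rewrite -linearB; apply: le_lt_trans (BK _) _.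
rewrite ltr_pdivlMr // in xv; apply: le_lt_trans xv.
by rewrite mulrC ler_wpM2l ?rnorm_ge0// lerDl.
Qed.

Lemma closed_set0 : closed [set 0 : X].
Proof.
apply/closed_adherent => x x0; apply: rnorm0_eq0; apply/eqP.
rewrite eq_le rnorm_ge0 andbT; apply/ler_addgt0Pr => e e0; rewrite add0r.
by have [_ /= -> ] := x0 e e0; rewrite subr0 => /ltW.
Qed.

(** The subspace R(B) + N, that is, the range of the operator induced by B modulo N. *)
Definition range_mod B N : set X := [set y | exists x, N (B x - y)].

Lemma subspace_range_mod B N : is_subspace N -> is_subspace (range_mod B N).
Proof.
move=> sN; split=> [|c x y [u ux] [v vy]].
  by exists 0; rewrite linear0 subrr; apply: subspace0.
exists (c *: u + v); rewrite linearP opprD addrACA -scalerBr.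
by apply: sN.2.
Qed.

(** An equation modulo N that can be solved up to a fixed fraction of the right-hand
side can be solved exactly: the remainders decrease geometrically, so the
successive corrections sum up. E contains the remainders, E' the
corrections. This one argument serves the open mapping theorem, its converse and
the surjectivity of perturbed operators. *)
Lemma iterate_solve B N E E' (C q : R) : bounded_op B ->
  is_subspace N -> closed N -> is_subspace E' -> closed E' -> 0 <= C -> 0 <= q < 1 ->
  (forall y, E y -> exists2 x, E' x /\ rnorm x <= C * rnorm y &
    exists2 n, N n & E (y - B x - n) /\ rnorm (y - B x - n) <= q * rnorm y) ->
  forall y, E y -> exists2 x, E' x /\ rnorm x <= C / (1 - q) * rnorm y & N (B x - y).
Proof.
move=> [K K0 BK] sN /closed_adherent cN sE' /closed_adherent cE' C0 qP step y Ey.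
have /choice[f fP] : forall y, exists p : X * X, E y ->
    [/\ E' p.1, rnorm p.1 <= C * rnorm y, N p.2, E (y - B p.1 - p.2) &
        rnorm (y - B p.1 - p.2) <= q * rnorm y].
  move=> z; have [Ez|nEz] := pselect (E z); last by exists (0, 0).
  by have [x [? ?] [n ? [? ?]]] := step z Ez; exists (x, n).
pose r k := iter k (fun z => z - B (f z).1 - (f z).2) y.
pose s k := \sum_(i < k) (f (r i)).1.
have Er k : E (r k) by elim: k => // k IH; have [] := fP _ IH.
have /andP[q0 q1] := qP.
have rq k : rnorm (r k) <= q ^+ k * rnorm y.
  elim: k => [|k IH]; first by rewrite expr0 mul1r.
  have [_ _ _ _ /le_trans] := fP _ (Er k); apply.
  by rewrite exprS -mulrA ler_wpM2l.
have E's k : E' (s k) by apply: subspace_sum => // i; have [] := fP _ (Er i).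
have Ns k : N (B (s k) + r k - y).
  elim: k => [|k IH].
    by rewrite /s big_ord0 linear0 add0r subrr; apply: subspace0.
  rewrite /s big_ord_recr /= -/(s k) linearD.
  have -> : B (s k) + B (f (r k)).1 + (r k - B (f (r k)).1 - (f (r k)).2) - y =
     B (s k) + r k - y - (f (r k)).2.
    by rewrite addrA addrACA subrr addr0 [RHS]addrAC.
  by have [_ _ ? _ _] := fP _ (Er k); apply: subspaceB.
have sM k : rnorm (s k.+1 - s k) <= C * rnorm y * q ^+ k.
  rewrite /s big_ord_recr /= addrAC subrr add0r.
  have [_ /le_trans + _ _ _] := fP _ (Er k); apply.
  by rewrite -mulrA ler_wpM2l // mulrC.
have [l lP] := geometric_lim qP sM.
have small D e : 0 < e -> exists k, D * q ^+ k < e by apply: geometric_small.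
exists l; first split.
- apply: cE' => e e0; have [k ke] := small (C * rnorm y / (1 - q)) e e0.
  exists (s k) => //; rewrite rnormB; apply: le_lt_trans (lP k) _.
  by rewrite mulrAC.
- have := lP 0%N; rewrite /s big_ord0 sub0r rnormN expr0 mulr1 => /le_trans; apply.
  by rewrite mulrAC.
- apply: cN => e e0.
  have [k ke] := small (K * (C * rnorm y / (1 - q)) + rnorm y) e e0.
  exists (B (s k) + r k - y) => //.
  have -> : B l - y - (B (s k) + r k - y) = B (l - s k) - r k.
    by rewrite opprB addrA subrK linearB opprD addrA.
  apply: le_lt_trans (rnormB_le _ _) (le_lt_trans _ ke).
  rewrite mulrDl; apply: lerD; last by rewrite mulrC.
  apply: le_trans (BK _) _; rewrite -mulrA ler_wpM2l // rnormB.
  by apply: le_trans (lP k) _; rewrite mulrAC.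
Qed.

End Subspaces.

(** * The open mapping theorem modulo a closed subspace *)

Section OpenMapping.
Context {R : realType} {X : completeNormedModType R[i]}.
Variables (B : {linear X -> X}) (N : set X).
Hypotheses (bB : bounded_op B) (sN : is_subspace N) (cN : closed N).
Implicit Types (x y z : X).

Lemma adherentB (V : set X) x y : is_subspace V -> adherent V x -> V y -> adherent V (x - y).
Proof.
move=> sV Vx Vy e e0; have [v Vv xv] := Vx e e0; exists (v - y); first by apply: subspaceB.
by rewrite opprB addrA subrK.
Qed.

Lemma half_itv : 0 <= (2^-1 : R) < 1.
Proof. by apply/andP; split; lra. Qed.

(** The converse of the open mapping theorem: a point y adherent to R(B) + N is
approximated within |y| / 2 by some element of R(B) + N, which is solvable with
control, and the error is again adherent. *)
Lemma closed_range_mod (C : R) : 0 <= C ->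
  (forall y, range_mod B N y -> exists2 x, rnorm x <= C * rnorm y & N (B x - y)) ->
  closed (range_mod B N).
Proof.
move=> C0 solve; have sZ := subspace_range_mod B sN.
apply/closed_adherent => y Zy.
have [||x _ Nx] := iterate_solve (E := adherent (range_mod B N)) (q := 2^-1)
  (C := 2 * C) bB sN cN subspaceT (@closedT X) _ half_itv _ Zy; last by exists x.
  by rewrite mulr_ge0.
move=> {Zy}y Zy; have [->|y0] := eqVneq y 0.
  exists 0; first by rewrite rnorm0 mulr0.
  exists 0; first exact: subspace0.
  rewrite linear0 !subr0 rnorm0 mulr0; split=> // e e0.
  by exists 0; [exact: subspace0 | rewrite subr0 rnorm0].
have yp : 0 < rnorm y by exact: rnorm_gt0.
have [|y' Zy' yy'] := Zy (2^-1 * rnorm y); first by rewrite mulr_gt0.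
have [x xy' Nx] := solve y' Zy'; exists x.
  split=> //; apply: le_trans xy' _.
  have := rnormB_le y (y - y'); rewrite opprB addrC subrK => h.
  have -> : 2 * C * rnorm y = C * (2 * rnorm y) by ring.
  by rewrite ler_wpM2l //; lra.
exists (y' - B x); first by rewrite -opprB; apply: subspaceN.
rewrite -addrA -opprD [B x + _]addrC subrK; split; last exact: ltW.
exact: adherentB.
Qed.

(** R(B) + N is the union over k of the sets P k of those y that are B x modulo N
with |x| <= k. Were none of them dense in some ball of R(B) + N, nested balls
avoiding P 0, P 1, ... would shrink to a point outside the union; this is the
category argument, carried out inside the closed subset R(B) + N. Density
of P k in a ball gives, by differences and scaling, approximate solutions of
every equation, and successive approximation makes them exact. *)
Lemma open_mapping : closed (range_mod B N) -> exists2 C : R, 0 <= C &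
  forall y, range_mod B N y -> exists2 x, rnorm x <= C * rnorm y & N (B x - y).
Proof.
move=> cZ; have sZ := subspace_range_mod B sN; set Z := range_mod B N in sZ cZ *.
pose P k := [set y | exists2 x, rnorm x <= k%:R & N (B x - y)].
have [k [y0 [r [Zy0 r0 yP]]]] : exists k y0 (r : R), [/\ Z y0, 0 < r &
    forall y, Z y -> rnorm (y - y0) < r -> adherent (P k) y].
  apply: contrapT => nP.
  have /choice[f fP] : forall a : nat * (X * R), exists b : X * R,
      Z a.2.1 -> 0 < a.2.2 -> [/\ Z b.1, 0 < b.2, b.2 <= a.2.2 / 2,
        rnorm (b.1 - a.2.1) <= a.2.2 / 2 &
        forall v, P a.1 v -> b.2 < rnorm (b.1 - v)].
    move=> [k [y0 r]] /=; have [Zy0|n] := pselect (Z y0); last by exists (0, 0).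
    have [r0|n] := ltP 0 r; last by exists (0, 0).
    apply: contrapT => nb; apply: nP; exists k, y0, (r / 2); split=> //.
      by rewrite divr_gt0.
    move=> y Zy yr; apply: contrapT => nPy; apply: nb.
    have [e [e0 eP]] : exists e : R, 0 < e /\ forall v, P k v -> e <= rnorm (y - v).
      apply: contrapT => ne; apply: nPy => e e0; apply: contrapT => nv.
      apply: ne; exists e; split=> // v Pv; rewrite leNgt; apply/negP => ve.
      by apply: nv; exists v.
    (* P k stays at distance at least e from y, so a ball of radius e / 2 misses it *)
    exists (y, Num.min (r / 2) (e / 2)) => _ _ /=; split=> //.
    - by rewrite lt_min !divr_gt0.
    - by rewrite ge_min lexx.
    - exact: ltW.
    - move=> v /eP; apply: lt_le_trans; rewrite gt_min; apply/orP; right.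
      by rewrite ltr_pdivrMr // mulr_natr mulr2n ltrDl.
  pose st k := iteri k (fun k a => f (k, a)) (0, 1).
  have stP k : Z (st k).1 /\ 0 < (st k).2.
    elim: k => [|k [Zk rk]]; first by split=> //; exact: subspace0.
    by have [] := fP (k, st k) Zk rk.
  have stS k : [/\ (st k.+1).2 <= (st k).2 / 2,
       rnorm ((st k.+1).1 - (st k).1) <= (st k).2 / 2 &
       forall v, P k v -> (st k.+1).2 < rnorm ((st k.+1).1 - v)].
    by have [Zk rk] := stP k; have [_ _ ? ? ?] := fP (k, st k) Zk rk.
  have rad k : (st k).2 <= 2^-1 ^+ k.
    elim: k => [|k IH]; first by rewrite expr0.
    have [/le_trans + _ _] := stS k; apply.
    by rewrite exprS mulrC ler_wpM2l ?invr_ge0.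
  have [l lP] := geometric_lim (u := fun k => (st k).1) (M := 1) half_itv
    (fun k => ltac:(have [_ /le_trans + _] := stS k; apply; have := rad k;
                    have [_] := stP k; lra)).
  have near k m : rnorm ((st (k + m)%N).1 - (st k).1) <= (st k).2 - (st (k + m)%N).2.
    elim: m => [|m IH]; first by rewrite addn0 !subrr rnorm0.
    rewrite addnS; apply: le_trans (rnorm_tri (st (k + m)%N).1 _ _) _.
    by have [? ? _] := stS (k + m)%N; lra.
  have lnear k : rnorm ((st k).1 - l) <= (st k).2.
    apply/ler_addgt0Pr => e e0.
    have [m me] := geometric_small 2 half_itv e0.
    apply: le_trans (rnorm_tri (st (k + m)%N).1 _ _) _; rewrite rnormB.
    have h1 := near k m; have h2 := lP (k + m)%N; have [_ h3] := stP (k + m)%N.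
    have h4 : (2^-1 : R) ^+ (k + m) <= 2^-1 ^+ m.
      by rewrite exprD ler_piMl ?exprn_ge0 ?exprn_ile1 ?invr_ge0 ?invf_le1 ?ler1n.
    move: h2 me; rewrite mul1r; set a := _ ^+ (k + m) in h4 *; set b := _ ^+ m in h4 *.
    have -> : a / (1 - 2^-1) = 2 * a by field.
    lra.
  have Zl : Z l.
    apply: ((closed_adherent Z).1 cZ) => e e0; have [k ke] := geometric_small 1 half_itv e0.
    exists (st k).1; first by have [] := stP k.
    rewrite rnormB; apply: le_lt_trans (lnear k) _.
    by apply: le_lt_trans (rad k) _; rewrite mul1r in ke.
  have [x Nx] := Zl.
  have Pl : P (Num.bound (rnorm x)) l.
    exists x => //; apply: ltW; apply: le_lt_trans (archi_boundP _); last exact: rnorm_ge0.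
    exact: lexx.
  have [_ _ /(_ _ Pl)] := stS (Num.bound (rnorm x)).
  by rewrite ltNge lnear.
have C0 : 0 <= 4 * k%:R / r by rewrite divr_ge0 ?mulr_ge0 ?ler0n // ltW.
exists (4 * k%:R / r / (1 - 2^-1)).
  by rewrite divr_ge0 //; lra.
move=> y Zy.
suff step : forall y, Z y -> exists2 x, [set: X] x /\ rnorm x <= 4 * k%:R / r * rnorm y &
    exists2 n, N n & Z (y - B x - n) /\ rnorm (y - B x - n) <= 2^-1 * rnorm y.
  have [x [_ ?] ?] := iterate_solve bB sN cN subspaceT (@closedT X) C0 half_itv step Zy.
  by exists x.
move=> {Zy}y Zy; have [->|yn0] := eqVneq y 0.
  exists 0; first by rewrite rnorm0 mulr0.
  exists 0; first exact: subspace0.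
  by rewrite linear0 !subr0 rnorm0 mulr0; split => //; exact: subspace0.
have yp : 0 < rnorm y by exact: rnorm_gt0.
(* t scales y to half the radius of the ball *)
pose t := r / (2 * rnorm y).
have t0 : 0 < t by rewrite divr_gt0 // mulr_gt0.
have tC : (t%:C)%C != 0 by apply/eqP => /complexI/eqP; rewrite gt_eqF.
(* errors of r / 8 at two points add up to |y| / 2 after division by t *)
have r8 : 0 < r / 8 by rewrite divr_gt0.
have [||v1 [x1 x1k Nx1] yv1] := yP ((t%:C)%C *: y + y0) _ _ _ r8.
- exact: sZ.2.
- rewrite addrK rnormZ rnormC gtr0_norm // /t.
  have -> : r / (2 * rnorm y) * rnorm y = r / 2 by field; rewrite gt_eqF.
  by rewrite ltr_pdivrMr // mulr_natr mulr2n ltrDl.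
have [|v2 [x2 x2k Nx2] yv2] := yP y0 Zy0 _ _ r8; first by rewrite subrr rnorm0.
pose c := ((t^-1)%:C)%C : R[i].
have rc : rnorm c = t^-1 by rewrite rnormC gtr0_norm // invr_gt0.
have ct : c * (t%:C)%C = 1 by rewrite /c fmorphV mulVf.
exists (c *: (x1 - x2)).
  split=> //; rewrite rnormZ rc.
  have -> : 4 * k%:R / r * rnorm y = t^-1 * (k%:R + k%:R).
    by rewrite /t; field; rewrite !gt_eqF.
  rewrite ler_wpM2l ?invr_ge0 ?(ltW t0)//.
  by apply: le_trans (rnormB_le _ _) _; apply: lerD.
exists (c *: (v1 - v2) - B (c *: (x1 - x2))).
  rewrite linearZ /= -scalerBr; apply: subspaceZ => //; rewrite linearB opprB addrA.
  have -> : v1 - v2 + B x2 - B x1 = (B x2 - v2) - (B x1 - v1).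
    by rewrite opprB addrA; congr (_ - _); rewrite addrAC [RHS]addrAC (addrC v1).
  exact: subspaceB.
rewrite -addrA -opprD [B _ + _]addrC subrK; split.
  apply: subspaceB => //; apply: subspaceZ => //.
  by apply: subspaceB => //; [exists x1 | exists x2].
rewrite -[y in X in rnorm X]scale1r -ct -scalerA -scalerBr rnormZ rc.
have -> : 2^-1 * rnorm y = t^-1 * (r / 4) by rewrite /t; field; rewrite !gt_eqF.
rewrite ler_wpM2l ?invr_ge0 ?(ltW t0)//.
have -> : (t%:C)%C *: y - (v1 - v2) = ((t%:C)%C *: y + y0 - v1) - (y0 - v2).
  by rewrite (addrAC _ y0) !opprB addrACA subrr addr0 addrA [LHS]addrAC.
apply: le_trans (rnormB_le _ _) _; lra.
Qed.

End OpenMapping.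

(** * Finite quotient dimension and one-dimensional extensions *)

Section FiniteExtensions.
Context {R : realType} {X : completeNormedModType R[i]}.
Implicit Types (V W N F : set X) (x y z : X).

Lemma dim_quot_ltP V W : (dim_quot V W < +oo)%E <->
  exists m, forall n (v : 'I_n -> X), free_mod V W v -> (n <= m)%N.
Proof.
split=> [dfin|[m mP]].
- apply: contrapT => nb.
  have unb k : exists2 n, (k < n)%N & exists v : 'I_n -> X, free_mod V W v.
    apply: contrapT => nk; apply: nb; exists k => n v vF; rewrite leqNgt.
    by apply/negP => kn; apply: nk; exists n => //; exists v.
  have sup_ge k : ((k%:R)%:E <= dim_quot V W)%E.
    have [n kn nv] := unb k; apply: (@le_trans _ _ (n%:R)%:E).
      by rewrite lee_fin ler_nat ltnW.
    by apply: ereal_sup_ubound; exists n.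
  move: dfin sup_ge; case: (dim_quot V W) => [r| |] // _.
    move=> /(_ (Num.bound r)); rewrite lee_fin leNgt => /negP; apply.
    have [r0|r0] := leP 0 r; first exact: archi_boundP.
    by rewrite (lt_le_trans r0).
  by move=> /(_ 0%N); rewrite leNgt ltNye.
- apply: (@le_lt_trans _ _ (m%:R)%:E); last exact: ltry.
  apply: ge_ereal_sup => _ [n [v vF] <-].
  by rewrite lee_fin ler_nat; exact: mP vF.
Qed.

Lemma dim_quot_le_sub V W V' W' :
  (forall n (v : 'I_n -> X), free_mod V W v -> exists w : 'I_n -> X, free_mod V' W' w) ->
  (dim_quot V' W' < +oo)%E -> (dim_quot V W < +oo)%E.
Proof.
move=> VV' /dim_quot_ltP [m mP]; apply/dim_quot_ltP; exists m => n v /VV' [w].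
exact: mP.
Qed.

Lemma dim_quot0 V W : is_subspace W -> dim_quot V W = 0%E -> V `<=` W.
Proof.
move=> sW VW0 v Vv; apply: contrapT => nWv.
have : (1 <= dim_quot V W)%E.
  apply: ereal_sup_ubound; exists 1%N => //; exists (fun=> v); split=> // c.
  rewrite big_ord1 => Wc i; rewrite (ord1 i); apply: contrapT => /eqP c0; apply: nWv.
  by rewrite -[v]scale1r -(mulVf c0) -scalerA; apply: subspaceZ.
by rewrite VW0 lee_fin ler10.
Qed.

(** If f maps V into g(V'), then choosing preimages sends a family that is
independent modulo W to one that is independent modulo W': a relation between the
preimages is mapped by g to a relation between the images under f. All the
comparisons of kernels of powers below are of this form. *)
Lemma dim_quot_transfer V W V' W' (f g : {linear X -> X}) : is_subspace V ->
  (forall x, V x -> exists2 y, V' y & f x = g y) ->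
  (forall x, V x -> f x = 0 -> W x) -> (forall y, W' y -> g y = 0) ->
  (dim_quot V' W' < +oo)%E -> (dim_quot V W < +oo)%E.
Proof.
move=> sV fg fW gW'; apply: dim_quot_le_sub => n v [Vv vF].
have /choice[w wP] : forall i, exists y, V' y /\ f (v i) = g y.
  by move=> i; have [y ? ?] := fg _ (Vv i); exists y.
exists w; split=> [i|c W'c]; first by have [] := wP i.
apply: vF; apply: fW.
  by apply: subspace_sum => // i; apply: subspaceZ.
rewrite -[RHS](gW' _ W'c) !linear_sum; apply: eq_bigr => i _.
by rewrite !linearZ /=; have [_ ->] := wP i.
Qed.

(** The subspace F + C x. *)
Definition add_line F x : set X := [set y | exists c : R[i], F (y - c *: x)].

Lemma sub_add_line F x : is_subspace F -> F `<=` add_line F x.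
Proof. by move=> sF y Fy; exists 0; rewrite scale0r subr0. Qed.

Lemma subspace_add_line F x : is_subspace F -> is_subspace (add_line F x).
Proof.
move=> sF; split=> [|c y z [a Fa] [b Fb]].
  by exists 0; rewrite scale0r subr0; apply: subspace0.
exists (c * a + b); rewrite scalerDl opprD addrACA -scalerA -scalerBr.
exact: sF.2.
Qed.

(** Intervals [a - t, a + t] that meet pairwise have a common point: Helly's theorem
on the line. It replaces a choice of Cauchy sequences. *)
Lemma nested_intervals (P : R -> R -> Prop) : (exists a t, P a t) ->
  (forall a t b s, P a t -> P b s -> a - t <= b + s) ->
  exists l, forall a t, P a t -> `|a - l| <= t.
Proof.
move=> [a0 [t0 P0]] Pab.
pose S := [set r | exists a t, P a t /\ r = a - t].
have S0 : S !=set0 by exists (a0 - t0), a0, t0.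
have ubS b s : P b s -> ubound S (b + s) by move=> Pb r [a [t [Pa ->]]]; apply: Pab.
exists (sup S) => a t Pat.
have le1 : sup S <= a + t by apply: ge_sup => //; apply: ubS.
have le2 : a - t <= sup S.
  by apply: ub_le_sup; [exists (a0 + t0); apply: ubS | exists a, t].
by rewrite ler_norml; apply/andP; split; lra.
Qed.

Lemma complex_le (c : R[i]) : rnorm c <= `|complex.Re c| + `|complex.Im c|.
Proof.
have -> : c = ((complex.Re c)%:C + (complex.Im c)%:C * 'i)%C.
  by case: c => a b; rewrite /=; simpc.
apply: le_trans (rnormD_le _ _) _; rewrite rnormM rnormi mulr1 !rnormC.
by case: c => a b /=; simpc.
Qed.

Lemma dist_gt0 F x : closed F -> ~ F x ->
  exists2 e : R, 0 < e & forall y, F y -> e <= rnorm (x - y).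
Proof.
move=> /closed_adherent cF nFx; apply: contrapT => ne; apply: nFx; apply: cF => e e0.
apply: contrapT => nv; apply: ne; exists e => // y Fy; rewrite leNgt.
by apply/negP => xy; apply: nv; exists y.
Qed.

Lemma add_line_coef F x (e : R) : is_subspace F ->
  (forall y, F y -> e <= rnorm (x - y)) ->
  forall y (c : R[i]), F (y - c *: x) -> rnorm c * e <= rnorm y.
Proof.
move=> sF eP y c Fy; have [->|c0] := eqVneq c 0.
  by rewrite rnorm0 mul0r rnorm_ge0.
have := eP (- c^-1 *: (y - c *: x)) (subspaceZ _ sF Fy).
rewrite scaleNr opprK scalerBr scalerA mulVf // scale1r addrC subrK rnormZ rnormV.
by rewrite ler_pdivlMl // rnorm_gt0.
Qed.

(** Let d > 0 be the distance from x to F, for x outside F. If c x + z and c' x + z', with z and z' in F,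
are both close to y, then |c - c'| d is small. So the real and the imaginary
parts of the admissible coefficients are confined to pairwise meeting intervals,
whose common points give the coefficient of y. *)
Lemma closed_add_line F x : is_subspace F -> closed F -> closed (add_line F x).
Proof.
move=> sF cF; have [Fx|nFx] := pselect (F x).
  suff -> : add_line F x = F by [].
  apply/seteqP; split=> [y [c Fc]|]; last exact: sub_add_line.
  by rewrite -(subrK (c *: x) y); apply: subspaceD => //; apply: subspaceZ.
have [d d0 dP] := dist_gt0 cF nFx.
apply/closed_adherent => y ay.
pose P (c : R[i]) t := exists2 z, F z & rnorm (y - c *: x - z) < d * t.
have P_ex t : 0 < t -> exists c, P c t.
  move=> t0; have [v [c Fc] yv] := ay (d * t) (mulr_gt0 d0 t0).
  by exists c, (v - c *: x) => //; rewrite opprB addrA subrK.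
have PP c t c' t' : P c t -> P c' t' -> rnorm (c - c') <= t + t'.
  move=> [z Fz yz] [z' Fz' yz'].
  have := add_line_coef sF dP (y := (y - c' *: x - z') - (y - c *: x - z)) (c := c - c').
  have -> : y - c' *: x - z' - (y - c *: x - z) - (c - c') *: x = z - z'.
    rewrite scalerBl !opprB !addrA [LHS](ACl (4*3*(1*6)*(2*7)*(5*8))).
    by rewrite /= !subrr addNr !addr0.
  move=> /(_ (subspaceB sF Fz Fz')) h.
  rewrite -(ler_pM2r d0) (le_trans h)// (le_trans (rnormB_le _ _))//.
  by rewrite mulrC mulrDr; lra.
have PX (g : R[i] -> R) : {morph g : c c' / c - c'} -> (forall c, `|g c| <= rnorm c) ->
    exists l, forall c t, P c t -> `|g c - l| <= t.
  move=> gB gP.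
  have [|a t b s [c [Pc ->]] [c' [Pc' ->]]|l lP] :=
     @nested_intervals (fun a t => exists c, P c t /\ a = g c).
  - by have [c Pc] := P_ex 1 ltr01; exists (g c), 1, c.
  - have := le_trans (gP _) (PP _ _ _ _ Pc Pc'); rewrite gB => /(le_trans (ler_norm _)).
    lra.
  by exists l => c t Pc; apply: lP; exists c.
have ReB : {morph @complex.Re R : c c' / c - c'} by move=> [? ?] [? ?].
have [a aP] := PX _ ReB (@Re_le R).
have ImB : {morph @complex.Im R : c c' / c - c'} by move=> [? ?] [? ?].
have [b bP] := PX _ ImB (@Im_le R).
exists (a +i* b)%C; move/closed_adherent: cF; apply => e e0.
have K0 : 0 < d + 2 * rnorm x by rewrite ltr_wpDr ?mulr_ge0 ?rnorm_ge0.
have [c Pc] := P_ex (e / (d + 2 * rnorm x)) (divr_gt0 e0 K0).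
have [z Fz yz] := Pc; exists z => //.
have -> : y - (a +i* b)%C *: x - z = (y - c *: x - z) + (c - (a +i* b)%C) *: x.
  by rewrite scalerBl [LHS]addrAC [_ - c *: x - z]addrAC addrA subrK.
apply: le_lt_trans (rnormD_le _ _) _; rewrite rnormZ.
have cab : rnorm (c - (a +i* b)%C) <= 2 * (e / (d + 2 * rnorm x)).
  have := aP _ _ Pc; have := bP _ _ Pc; have := complex_le (c - (a +i* b)%C).
  by case: c {Pc yz} => r s /=; lra.
have -> : e = d * (e / (d + 2 * rnorm x)) + 2 * (e / (d + 2 * rnorm x)) * rnorm x.
  by field; rewrite gt_eqF.
by apply: ltr_leD => //; rewrite ler_wpM2r ?rnorm_ge0.
Qed.

End FiniteExtensions.

(** * Finite extensions and perturbation of finite dimension *)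

Section PartialSpans.
Context {R : realType} {X : completeNormedModType R[i]}.
Implicit Types (V W N F : set X) (x y z : X).

(** The span of N and the first k vectors of v, as sums over all of v in which the
later coefficients vanish; this way the index set does not change with k, and the
span grows by one line at a time. *)
Definition partial_span N n (v : 'I_n -> X) (k : nat) : set X :=
  [set y | exists2 c : 'I_n -> R[i], forall i : 'I_n, (k <= i)%N -> c i = 0 &
     N (y - \sum_i c i *: v i)].

Lemma partial_span0 N n (v : 'I_n -> X) : partial_span N v 0 = N.
Proof.
apply/seteqP; split=> [y [c c0]|y Ny].
  by rewrite big1 ?subr0 // => i _; rewrite c0 ?scale0r.
by exists (fun=> 0) => //; rewrite big1 ?subr0 // => i _; rewrite scale0r.
Qed.

Lemma partial_spanS N n (v : 'I_n -> X) (i : 'I_n) :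
  partial_span N v i.+1 = add_line (partial_span N v i) (v i).
Proof.
have addE (c : 'I_n -> R[i]) a y : c i = 0 ->
    y - \sum_j (if j == i then a else c j) *: v j = y - a *: v i - \sum_j c j *: v j.
  move=> ci; rewrite [in RHS](bigD1 i) //= ci scale0r add0r.
  rewrite (bigD1 i) //= eqxx opprD addrA; congr (_ - _).
  by apply: eq_bigr => j /negPf ->.
apply/seteqP; split=> y.
- move=> [c c0 Ny]; exists (c i), (fun j => if j == i then 0 else c j).
    move=> j ij; case: eqP => // /eqP ji; apply: c0.
    by rewrite ltn_neqAle ij andbT eq_sym.
  rewrite -addE ?eqxx //; congr N : Ny; congr (_ - _); apply: eq_bigr => j _.
  by case: eqP => // ->.
- move=> [a [c c0 Ny]]; exists (fun j => if j == i then a else c j).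
    move=> j ij; case: eqP => [ji|_]; first by rewrite ji ltnn in ij.
    by apply: c0; apply: ltnW.
  by rewrite addE // c0.
Qed.

Lemma partial_span_ind (P : set X -> Prop) N n (v : 'I_n -> X) : P N ->
  (forall F i, P F -> P (add_line F (v i))) ->
  forall k, (k <= n)%N -> P (partial_span N v k).
Proof.
move=> PN PS; elim=> [|k IH] kn; first by rewrite partial_span0.
by rewrite (partial_spanS N v (Ordinal kn)); apply: PS; apply: IH; apply: ltnW.
Qed.

Lemma partial_span_mono N n (v : 'I_n -> X) k l : (k <= l)%N ->
  partial_span N v k `<=` partial_span N v l.
Proof. by move=> kl y [c c0 Ny]; exists c => // i li; apply: c0; apply: leq_trans li. Qed.

Lemma free_partial_span V N n (v : 'I_n -> X) (i : 'I_n) :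
  free_mod V N v -> ~ partial_span N v i (v i).
Proof.
move=> [_ vF] [c c0 Ny].
have /vF/(_ i) : N (\sum_j (if j == i then 1 else - c j) *: v j).
  congr N : Ny; rewrite [in LHS](bigD1 i) //= c0 // scale0r add0r.
  rewrite [RHS](bigD1 i) //= eqxx scale1r; congr (_ + _).
  by rewrite -sumrN; apply: eq_bigr => j /negPf ->; rewrite scaleNr.
by rewrite eqxx => /eqP; rewrite oner_eq0.
Qed.

Lemma add_line_sub V F x : is_subspace V -> F `<=` V -> V x -> add_line F x `<=` V.
Proof.
move=> sV FV Vx y [c Fc]; rewrite -(subrK (c *: x) y).
by apply: subspaceD => //; [apply: FV | apply: subspaceZ].
Qed.

(** A maximal family in V that is independent modulo W spans V modulo W, so V is
obtained from W by adding finitely many lines. *)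
Lemma dim_quot_ind (P : set X -> Prop) V W : is_subspace V -> is_subspace W ->
  W `<=` V -> (dim_quot V W < +oo)%E -> P W ->
  (forall F x, is_subspace F -> P F -> P (add_line F x)) -> P V.
Proof.
move=> sV sW WV /dim_quot_ltP [m mP] PW PS.
pose Q n := `[< exists v : 'I_n -> X, free_mod V W v >].
have Q0 : exists n, Q n.
  by exists 0%N; apply/asboolP; exists (fun=> 0); split=> [[]|c _ []].
have Qm n : Q n -> (n <= m)%N by move=> /asboolP [v]; apply: mP.
have [n /asboolP [v vF] nmax] := ex_maxnP Q0 Qm.
suff -> : V = partial_span W v n.
  suff /(_ (leqnn n)) [] : (n <= n)%N ->
    is_subspace (partial_span W v n) /\ P (partial_span W v n) by [].
  apply: (@partial_span_ind (fun F => is_subspace F /\ P F)) => // F i [sF PF].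
  by split; [apply: subspace_add_line | apply: PS].
apply/seteqP; split=> [y Vy|]; last first.
  apply: (@partial_span_ind (fun F => F `<=` V)) => // F i FV.
  by apply: add_line_sub => //; apply: vF.1.
have : ~ free_mod V W (fun i : 'I_n.+1 => oapp v y (unlift ord0 i)).
  by move=> F; have /nmax : Q n.+1 by [apply/asboolP; eexists; exact: F]; rewrite ltnn.
move=> nF; apply: contrapT => ny; apply: nF; split=> [i|c].
  by case: unliftP => [j|] _ //=; apply: vF.1.
rewrite big_ord_recl unlift_none /=.
under eq_bigr do rewrite liftK /=.
move=> Wc; have c0 : c ord0 = 0.
  apply: contrapT => /eqP c0; apply: ny.
  exists (fun i => - (c ord0)^-1 * c (lift ord0 i)) => [i|]; first by rewrite leqNgt ltn_ord.
  have := subspaceZ (c ord0)^-1 sW Wc; rewrite scalerDr scalerA mulVf // scale1r.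
  congr (W (_ + _)); rewrite scaler_sumr -sumrN; apply: eq_bigr => i _.
  by rewrite scalerA mulNr scaleNr opprK.
move: Wc; rewrite c0 scale0r add0r => /vF.2 cF i.
by case: (unliftP ord0 i) => [j|] ->.
Qed.

(** Bounded parts of F have finite nets modulo N. This is local compactness of F / N,
expressed in X. *)
Definition tot_bounded_mod N F := forall M e : R, 0 < e -> exists s : seq X,
  forall x, F x -> rnorm x <= M ->
    exists2 t, t \in s & exists2 n, N n & rnorm (x - n - t) < e.

Lemma segment_net (M h : R) : 0 < h ->
  exists s : seq R, forall a, `|a| <= M -> exists2 b, b \in s & `|a - b| < h.
Proof.
move=> h0; pose L := Num.truncn (2 * M / h).
exists [seq - M + k%:R * h | k <- iota 0 L.+1] => a; rewrite ler_norml => /andP[Ma aM].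
have aM0 : 0 <= (a + M) / h by rewrite divr_ge0 ?(ltW h0) //; lra.
have := truncn_itv aM0; set k := Num.truncn _ => /andP[].
rewrite ler_pdivlMr // ltr_pdivrMr // -natr1 mulrDl mul1r => k1 k2.
exists (- M + k%:R * h).
  apply/mapP; exists k => //; rewrite mem_iota leq0n add0n ltnS.
  apply: le_truncn; rewrite ler_pM2r ?invr_gt0//; lra.
by rewrite ltr_norml; apply/andP; split; lra.
Qed.

Lemma disc_net (M h : R) : 0 < h ->
  exists s : seq R[i], forall a, rnorm a <= M -> exists2 b, b \in s & rnorm (a - b) < h.
Proof.
move=> h0; have [s sP] := segment_net M (divr_gt0 h0 (ltr0n _ 2)).
exists [seq (b +i* c)%C | b <- s, c <- s] => a aM.
have [b bs ab] := sP _ (le_trans (Re_le a) aM).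
have [c cs ac] := sP _ (le_trans (Im_le a) aM).
exists (b +i* c)%C; first by apply/allpairsP; exists (b, c).
apply: le_lt_trans (complex_le _) _; case: a ab ac {aM} => p q /=; lra.
Qed.

(** Unless x is in F, it is at positive distance from F, so the coefficient of x in a
bounded vector of F + C x is bounded; nets of a disc and of a bounded part of F
combine. *)
Lemma tot_bounded_add_line N F x : is_subspace F -> closed F ->
  tot_bounded_mod N F -> tot_bounded_mod N (add_line F x).
Proof.
move=> sF cF tF; have [Fx|nFx] := pselect (F x).
  suff -> : add_line F x = F by [].
  by apply/seteqP; split; [apply: add_line_sub | apply: sub_add_line].
have [d d0 dP] := dist_gt0 cF nFx.
have xp : 0 < rnorm x.
  rewrite rnorm_gt0 //; apply/eqP => x0; apply: nFx; rewrite x0; exact: subspace0.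
move=> M e e0.
have [s sP] := disc_net (M / d) (divr_gt0 (divr_gt0 e0 (ltr0n _ 2)) xp).
have [s' s'P] := tF (M + M / d * rnorm x) _ (divr_gt0 e0 (ltr0n _ 2)).
exists [seq b *: x + t | b <- s, t <- s'] => y [c Fc] yM.
have cM : rnorm c <= M / d.
  by rewrite ler_pdivlMr //; apply: le_trans (add_line_coef sF dP Fc) yM.
have [b bs cb] := sP c cM.
have [|t ts [n Nn nt]] := s'P _ Fc.
  apply: le_trans (rnormB_le _ _) (lerD yM _).
  by rewrite rnormZ ler_wpM2r ?rnorm_ge0.
exists (b *: x + t); first by apply/allpairsP; exists (b, t).
exists n => //.
have -> : y - n - (b *: x + t) = (c - b) *: x + (y - c *: x - n - t).
  rewrite scalerBl opprD !addrA [RHS](ACl (3*5*2*6*(1*4))) /= subrr addr0.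
  by [].
apply: le_lt_trans (rnormD_le _ _) _; rewrite rnormZ.
by rewrite ltr_pdivlMr // in cb; lra.
Qed.

Lemma tot_bounded_refl N : tot_bounded_mod N N.
Proof.
move=> M e e0; exists [:: 0] => x Nx _; exists 0; first by rewrite inE.
by exists x => //; rewrite subrr subr0 rnorm0.
Qed.

Lemma finite_extension N W : is_subspace N -> closed N -> is_subspace W ->
  N `<=` W -> (dim_quot W N < +oo)%E -> closed W /\ tot_bounded_mod N W.
Proof.
move=> sN cN sW NW dW.
apply: (dim_quot_ind (P := fun F => closed F /\ tot_bounded_mod N F) sW sN NW dW).
  by split=> //; exact: tot_bounded_refl.
move=> F x sF [cF tF]; split; first exact: closed_add_line.
exact: tot_bounded_add_line.
Qed.

Lemma riesz F x : is_subspace F -> closed F -> ~ F x ->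
  exists (D : R) z, [/\ 0 < D, F z, rnorm (x - z) < 2 * D &
     forall y, F y -> D <= rnorm (x - y)].
Proof.
move=> sF cF nFx; have [d d0 dP] := dist_gt0 cF nFx.
pose S := [set rnorm (x - y) | y in F].
have S0 : S !=set0 by exists (rnorm (x - 0)), 0 => //; exact: subspace0.
have lS : lbound S d by move=> _ [y Fy <-]; apply: dP.
have hS : has_inf S by split=> //; exists d.
have D0 : 0 < inf S by apply: lt_le_trans d0 _; apply: lb_le_inf.
have [_ [z Fz <-] zD] := inf_adherent D0 hS.
exists (inf S), z; split=> //; first by lra.
by move=> y Fy; apply: ge_inf; [exists d | exists y].
Qed.

(** Suppose that V contains a long family independent modulo N. Riesz's lemma turns
it into vectors w of V with |w| <= 2 whose mutual distances are at least 1 modulo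
N. Each w is within 1/4 of a vector of W, which is itself within 1/8, modulo N, of
one of finitely many points, their number depending only on W. If two vectors w
share that point, they are at distance less than 1 modulo N. So the number of
points bounds the dimension of V / N. *)
Theorem finite_dim_near N V W : is_subspace N -> closed N ->
  is_subspace V -> is_subspace W -> N `<=` V -> N `<=` W ->
  (dim_quot W N < +oo)%E ->
  (forall x, V x -> exists2 w, W w & rnorm (x - w) <= 8^-1 * rnorm x) ->
  (dim_quot V N < +oo)%E.
Proof.
move=> sN cN sV sW NV NW dW near.
have [_ tW] := finite_extension sN cN sW NW dW.
have [|s sP] := tW 4 8^-1; first by rewrite invr_gt0.
apply/dim_quot_ltP; exists (size s) => n v vF; rewrite leqNgt; apply/negP => sn.
pose F k := partial_span N v k.
have FP k : (k <= n)%N -> [/\ is_subspace (F k), closed (F k) & F k `<=` V].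
  apply: (@partial_span_ind (fun G => [/\ is_subspace G, closed G & G `<=` V])) => //.
  move=> G i [sG cG GV]; split; first exact: subspace_add_line.
    exact: closed_add_line.
  by apply: add_line_sub => //; apply: vF.1.
have /choice[w wP] : forall i : 'I_n, exists w, [/\ V w, F i.+1 w, rnorm w <= 2 &
    forall y, F i y -> 1 <= rnorm (w - y)].
  move=> i; have [sF cF FV] := FP i (ltnW (ltn_ord i)).
  have [D [z [D0 Fz xz Dy]]] := riesz sF cF (free_partial_span (i := i) vF).
  have cD : rnorm ((D^-1)%:C)%C = D^-1 by rewrite rnormC gtr0_norm // invr_gt0.
  have Dc : ((D^-1)%:C)%C * (D%:C)%C = 1 :> R[i].
    by rewrite -rmorphM /= mulVf ?gt_eqF.
  exists (((D^-1)%:C)%C *: (v i - z)); split.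
  - by apply: subspaceZ => //; apply: subspaceB => //; [apply: vF.1 | apply: FV].
  - rewrite /F partial_spanS; exists ((D^-1)%:C)%C.
    by rewrite scalerBr addrC addKr; apply: subspaceN => //; apply: subspaceZ.
  - by rewrite rnormZ cD ler_pdivrMl // mulrC ltW.
  - move=> y Fy; have := Dy (z + (D%:C)%C *: y) (subspaceD sF Fz (subspaceZ _ sF Fy)).
    rewrite opprD addrA => h.
    rewrite -[y]scale1r -Dc -scalerA -scalerBr rnormZ cD.
    by rewrite ler_pdivlMl // mulr1.
have /choice[f fP] : forall i : 'I_n, exists j : 'I_(size s),
    exists2 m, N m & rnorm (w i - m - tnth (in_tuple s) j) <= 8^-1 + 4^-1.
  move=> i; have [Vw _ w2 _] := wP i; have [u Wu wu] := near _ Vw.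
  have [|t ts [m Nm mt]] := sP u Wu.
    have := rnormB_le (w i) (w i - u); rewrite opprB addrC subrK; lra.
  have ti : (index t s < size s)%N by rewrite index_mem.
  exists (Ordinal ti), m => //; rewrite (tnth_nth 0) /= nth_index //.
  have -> : w i - m - t = (w i - u) + (u - m - t).
    by rewrite !addrA subrK.
  apply: le_trans (rnormD_le _ _) _; lra.
have /injectivePn [i [j ij fij]] : ~~ injectiveb f.
  by apply: contraL sn => /injectiveP/leq_card; rewrite !card_ord -leqNgt.
wlog ji : i j ij fij / (j < i)%N.
  move=> H; case: (ltngtP i j) => [h|h|/val_inj h]; last by rewrite h eqxx in ij.
    by apply: (H j i) => //; rewrite eq_sym.
  exact: (H i j).
have [m Nm mi] := fP i; have [m' Nm' mj] := fP j; rewrite fij in mi.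
have [_ _ _ /(_ (w j + (m - m')))] := wP i.
have [_ Fwj _ _] := wP j.
have [sF _ _] := FP i (ltnW (ltn_ord i)).
have NF : N `<=` F i by rewrite -[X in X `<=` _](partial_span0 N v); apply: partial_span_mono.
have Fi : F i (w j + (m - m')).
  apply: subspaceD => //; first exact: (partial_span_mono ji Fwj).
  by apply: NF; apply: subspaceB.
move=> /(_ Fi).
have -> : w i - (w j + (m - m')) = (w i - m - tnth (in_tuple s) (f j)) -
    (w j - m' - tnth (in_tuple s) (f j)).
  set t := tnth _ _; rewrite !opprD !opprK !addrA [RHS](ACl (1*4*2*5*(3*6))) /=.
  by rewrite addNr addr0.
by apply/negP; rewrite -ltNge; apply: le_lt_trans (rnormB_le _ _) _; lra.
Qed.

End PartialSpans.

(** * Powers of an operator *)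

Section Iterates.
Context {R : realType} {X : completeNormedModType R[i]}.
Implicit Types (A B : {linear X -> X}) (x y : X) (mu : R[i]).

Lemma iter_is_linear A n : linear (iter n A).
Proof. by elim: n => // n IH c x y; rewrite /= IH linearP. Qed.

HB.instance Definition _ A n :=
  GRing.isLinear.Build R[i] X X _ (iter n A) (iter_is_linear A n).

Definition lin_iter A n : {linear X -> X} := iter n A.

Lemma bounded_op_iter A n : bounded_op A -> bounded_op (iter n A).
Proof.
move=> [K K0 AK]; exists (K ^+ n); first exact: exprn_ge0.
move=> x; elim: n => [|n IH]; first by rewrite expr0 mul1r.
by rewrite exprS -mulrA; apply: le_trans (AK _) _; rewrite ler_wpM2l.
Qed.

Lemma sub_scalarE A mu x : sub_scalar A mu x = A x - mu *: x.
Proof. by []. Qed.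

Lemma bounded_op_sub_scalar A mu : bounded_op A -> bounded_op (sub_scalar A mu).
Proof.
move=> [K K0 AK]; exists (K + rnorm mu); first by rewrite addr_ge0 ?rnorm_ge0.
move=> x; rewrite sub_scalarE mulrDl; apply: le_trans (rnormB_le _ _) _.
by rewrite rnormZ lerD.
Qed.

Lemma iter_sub_scalarC A mu m n x :
  iter m A (iter n (sub_scalar A mu) x) = iter n (sub_scalar A mu) (iter m A x).
Proof.
have comm1 y : iter m A (sub_scalar A mu y) = sub_scalar A mu (iter m A y).
  by rewrite !sub_scalarE linearB linearZ /= -iterSr.
by elim: n => //= n IH; rewrite comm1 IH.
Qed.

Lemma subspace_null A n : is_subspace (null A n).
Proof. exact: (subspace_preimage (lin_iter A n) subspace_set0). Qed.

Lemma closed_null A n : bounded_op A -> closed (null A n).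
Proof.
by move=> bA; apply: (closed_preimage (B := lin_iter A n)) closed_set0; apply: bounded_op_iter.
Qed.

Lemma subspace_ran A n : is_subspace (ran A n).
Proof.
split=> [|c _ _ [x _ <-] [y _ <-]]; first by exists 0 => //; rewrite linear0.
by exists (c *: x + y) => //; rewrite linearP.
Qed.

End Iterates.

(** * Small perturbations of a semi-regular operator *)

Section PerturbedSemiregular.
Context {R : realType} {X : completeNormedModType R[i]}.
Variables (A : {linear X -> X}) (N : set X).
Hypotheses (bA : bounded_op A) (sN : is_subspace N) (cN : closed N).
Hypothesis cR : forall k, closed (range_mod (lin_iter A k) N).
Hypothesis kerR : forall x, N (A x) -> forall k, range_mod (lin_iter A k) N x.
Implicit Types (x y z : X) (mu : R[i]) (C : R).

Definition hyper_range : set X := [set x | forall k, range_mod (lin_iter A k) N x].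

Lemma subspace_hyper_range : is_subspace hyper_range.
Proof.
have sR k := subspace_range_mod (lin_iter A k) sN.
by split=> [k|c x y Ex Ey k]; [apply: subspace0 | apply: (sR k).2].
Qed.

Lemma closed_hyper_range : closed hyper_range.
Proof.
apply/closed_adherent => x ax k; apply: ((closed_adherent _).1 (@cR k)) => e e0.
by have [v Ev xv] := ax e e0; exists v.
Qed.

(** If y = A^(k+1) w modulo N, then x - A^k w is in the kernel of A modulo N, and this
kernel is contained in R(A^k) + N by semi-regularity. *)
Lemma hyper_range_lift x y : hyper_range y -> N (A x - y) -> hyper_range x.
Proof.
move=> Ey Nxy k; have [w Nw] := Ey k.+1.
have sR := subspace_range_mod (lin_iter A k) sN.
have /kerR/(_ k) Rx : N (A (x - iter k A w)).
  rewrite linearB; have := subspaceB sN Nxy Nw.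
  by rewrite /= opprB addrA subrK.
rewrite -(subrK (iter k A w) x); apply: subspaceD => //.
by exists w; rewrite subrr; apply: subspace0.
Qed.

Definition lifting_constant C := 0 <= C /\
  forall y, range_mod A N y -> exists2 x, rnorm x <= C * rnorm y & N (A x - y).

Lemma lifting_constant_ex : exists C, lifting_constant C.
Proof. by have [C C0 CP] := open_mapping bA sN cN (@cR 1%N); exists C. Qed.

(* for C |mu| <= 1 / 32 the corrections below stay within |x| / 8 *)
Variables (C : R) (mu : R[i]).
Hypotheses (CP : lifting_constant C) (Cmu : C * rnorm mu <= 32^-1).

(** A solution of A x = y modulo N inside the hyper-range solves the perturbed
equation up to mu x, which is small and again in the hyper-range. *)
Lemma hyper_range_solve y : hyper_range y ->
  exists2 x, hyper_range x /\ rnorm mu * rnorm x <= 8^-1 * rnorm y &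
             N (sub_scalar A mu x - y).
Proof.
move=> Ey; have [C0 lift] := CP.
have q : 0 <= (32^-1 : R) < 1 by apply/andP; split; lra.
have sE := subspace_hyper_range.
have [|x [Ex xy] Nx] := iterate_solve (E := hyper_range) (B := sub_scalar A mu)
  (bounded_op_sub_scalar mu bA) sN cN sE closed_hyper_range C0 q _ Ey; last first.
  exists x => //; split=> //.
  apply: le_trans (ler_wpM2l (rnorm_ge0 mu) xy) _.
  have -> : rnorm mu * (C / (1 - 32^-1) * rnorm y) = C * rnorm mu * (32 / 31 * rnorm y).
    by field.
  have y0 : 0 <= 32 / 31 * rnorm y by rewrite mulr_ge0 ?rnorm_ge0.
  by apply: le_trans (ler_wpM2r y0 Cmu) _; lra.
move=> {Ey}y Ey; have [x xy Nx] := lift y (Ey 1%N).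
have Ex := hyper_range_lift Ey Nx.
exists x => //; exists (y - A x); first by rewrite -opprB; apply: subspaceN.
have -> : y - sub_scalar A mu x - (y - A x) = mu *: x.
  rewrite sub_scalarE !opprB !addrA [LHS](ACl (2*(1*5)*(3*4))) /=.
  by rewrite subrr addNr !addr0.
split; first exact: (subspaceZ _ sE Ex).
rewrite rnormZ mulrC; apply: le_trans (ler_wpM2r (rnorm_ge0 mu) xy) _.
by rewrite mulrAC ler_wpM2r ?rnorm_ge0.
Qed.

(** If z solves (A - mu) z = x modulo N, then A - mu maps x + mu z to A x modulo N,
and this is in N. *)
Lemma kernel_near_perturbed x : N (A x) ->
  exists2 g, hyper_range g /\ N (sub_scalar A mu g) & rnorm (x - g) <= 8^-1 * rnorm x.
Proof.
move=> NAx; have Ex : hyper_range x by exact: kerR.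
have [z [Ez zx] Nz] := hyper_range_solve Ex.
exists (x + mu *: z).
  split.
    have sE := subspace_hyper_range.
    exact: (subspaceD sE Ex (subspaceZ mu sE Ez)).
  rewrite [x + _]addrC linearP (sub_scalarE A mu x) addrA addrAC -scalerBr.
  by apply: subspaceD => //; apply: subspaceZ.
by rewrite opprD addrA subrr add0r rnormN rnormZ.
Qed.

(** Here A x = mu x modulo N, so a small solution u of A u = mu x modulo N yields the
element x - u of the kernel of A modulo N. *)
Lemma perturbed_near_kernel x : N (sub_scalar A mu x) ->
  exists2 w, N (A w) & rnorm (x - w) <= 8^-1 * rnorm x.
Proof.
move=> Nx; have [C0 lift] := CP.
have [|u ux Nu] := lift (mu *: x); first by exists x.
exists (x - u).
  have := subspaceB sN Nx Nu.
  by rewrite sub_scalarE opprB addrA subrK -(linearB A).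
rewrite opprB addrC subrK; apply: le_trans ux _; rewrite rnormZ mulrA.
by rewrite ler_wpM2r ?rnorm_ge0 // (le_trans Cmu) //; lra.
Qed.

(** Solve A x1 = y + mu x with control. Then x - x1 is in the kernel of A modulo N;
move it slightly, into the kernel of A - mu modulo N, and subtract the result
from x. *)
Lemma improve_solution x y : N (sub_scalar A mu x - y) ->
  exists2 x', rnorm x' <= 2 * C * rnorm y + 2^-1 * rnorm x & N (sub_scalar A mu x' - y).
Proof.
move=> Nx; have [C0 lift] := CP.
have Nx1 : N (A x - (y + mu *: x)) by rewrite opprD addrA addrAC.
have [|x1 x1y Nx2] := lift (y + mu *: x); first by exists x.
have [|g [_ Ng] gx] := @kernel_near_perturbed (x - x1).
  have := subspaceB sN Nx1 Nx2.
  by rewrite opprB addrA subrK -(linearB A).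
exists (x - g).
  have -> : x - g = x1 + (x - x1 - g).
    by rewrite !addrA [x1 + x]addrC addrK.
  apply: le_trans (rnormD_le _ _) _.
  have h0 := rnorm_ge0 x; have h1 := rnormB_le x x1.
  have h2 : C * rnorm (y + mu *: x) <= C * rnorm y + 32^-1 * rnorm x.
    apply: le_trans (ler_wpM2l C0 (rnormD_le _ _)) _.
    by rewrite mulrDr lerD2l rnormZ mulrA ler_wpM2r ?rnorm_ge0.
  have h4 : 0 <= C * rnorm y by rewrite mulr_ge0 ?rnorm_ge0.
  lra.
by rewrite linearB addrAC; apply: subspaceB.
Qed.

(** Starting from any solution, repeated improvement halves its excess over a multiple
of |y|; finitely many steps produce a solution bounded by a constant times |y|. *)
Lemma closed_range_perturbed : closed (range_mod (sub_scalar A mu) N).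
Proof.
have [C0 _] := CP.
apply: (closed_range_mod (bounded_op_sub_scalar mu bA) sN cN (C := 4 * C + 1)).
  by rewrite addr_ge0 ?mulr_ge0.
move=> y [x Nx]; have [y0|yn0] := eqVneq y 0.
  by exists 0; rewrite ?y0 ?rnorm0 ?mulr0 // linear0 subr0; apply: subspace0.
have approx k : exists2 x', rnorm x' <= 4 * C * rnorm y + rnorm x * 2^-1 ^+ k &
    N (sub_scalar A mu x' - y).
  elim: k => [|k [x' x'y /improve_solution [x'' x''x' Nx'']]].
    by exists x => //; rewrite expr0 mulr1 lerDr !mulr_ge0 ?rnorm_ge0.
  exists x'' => //; rewrite exprS; lra.
have [k kP] := geometric_small (rnorm x) half_itv (rnorm_gt0 yn0).
have [x' x'y Nx'] := approx k; exists x' => //; lra.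
Qed.

End PerturbedSemiregular.

(** * Essential ascent and closed ranges *)

Section EssentialAscent.
Context {R : realType} {X : completeNormedModType R[i]}.
Implicit Types (A B : {linear X -> X}) (x y : X) (mu : R[i]).

Definition fin_step A n := (dim_quot (null A n.+1) (null A n) < +oo)%E.

(** A^(n-m) embeds N(A^(n+1)) / N(A^n) into N(A^(m+1)) / N(A^m). *)
Lemma fin_step_le A m n : (m <= n)%N -> fin_step A m -> fin_step A n.
Proof.
move=> mn; apply: (dim_quot_transfer (f := lin_iter A n) (g := lin_iter A m)) => //.
- exact: subspace_null.
- move=> x; rewrite /null /= => Ax; exists (iter (n - m) A x).
    by rewrite /= -iterD subnKC.
  by rewrite /= -iterD subnKC.
Qed.

Lemma ess_ascent_fin A : (ess_ascent A < +oo)%E <-> exists n, fin_step A n.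
Proof.
split=> [Afin|[n An]].
- apply: contrapT => nA; move: Afin; rewrite ltNge => /negP; apply.
  by apply: le_ereal_inf_tmp => _ [n An <-]; case: nA; exists n.
- apply: (@le_lt_trans _ _ (n%:R)%:E); last exact: ltry.
  by apply: ereal_inf_lbound; exists n.
Qed.

Lemma ess_ascent_min A p : fin_step A p -> (forall n, fin_step A n -> (p <= n)%N) ->
  ess_ascent A = (p%:R)%:E.
Proof.
move=> Ap pmin; apply/eqP; rewrite eq_le; apply/andP; split.
  by apply: ereal_inf_lbound; exists p.
by apply: le_ereal_inf_tmp => _ [n An <-]; rewrite lee_fin ler_nat; apply: pmin.
Qed.

Lemma usf_led A : upper_semi_fredholm A -> left_ess_drazin_invertible A.
Proof.
move=> [dA cA]; exists 0%N; split=> //; apply: ess_ascent_min => //.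
Qed.

Lemma led_ess_ascent A : left_ess_drazin_invertible A -> (ess_ascent A < +oo)%E.
Proof. by move=> [n [-> _]]; exact: ltry. Qed.

(** By induction on j: A^j embeds the quotient of R(A^q) ∩ N(A^(j+1)) by
R(A^q) ∩ N(A^j) into R(A^(j+q)) ∩ N(A), a copy of N(A^(j+q+1)) / N(A^(j+q)).
So each step is a finite-dimensional extension of a closed subspace. *)
Lemma closed_ran_cap_null A q j : bounded_op A -> (forall n, (q <= n)%N -> fin_step A n) ->
  closed (ran A q `&` null A j).
Proof.
move=> bA fA; have sI k : is_subspace (ran A q `&` null A k).
  by apply: subspaceI; [apply: subspace_ran | apply: subspace_null].
elim: j => [|j IH].
  suff -> : ran A q `&` null A 0 = [set 0] by exact: closed_set0.
  apply/seteqP; split=> [x []//|_ ->]; split=> //; exact: subspace0 (subspace_ran A q).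
apply: (finite_extension (sI j) IH (sI j.+1) _ _).1.
  by move=> x [Rx Nx]; split=> //; rewrite /null /= Nx linear0.
apply: (dim_quot_transfer (f := lin_iter A j) (g := lin_iter A (j + q)) (sI j.+1)
  _ _ _ (fA (j + q)%N (leq_addl _ _))) => //.
- move=> _ [[u _ <-] Nu]; exists u; last by rewrite /= iterD.
  by move: Nu; rewrite /null /= iterD.
- by move=> x [Rx _] Ax; split.
Qed.

(** Let x be a limit of elements z of R(A^q). As R(A^q) + N(A^d) is closed, the
class of x is that of some A^q u, and the open mapping theorem writes each x - z
as A^q w plus a small element of N(A^d). Removing that small element from
A^q u - x leaves an element of R(A^q) ∩ N(A^d); so A^q u - x is adherent to
this closed intersection, whence x is in R(A^q). *)
Lemma closed_ran A q d : bounded_op A -> (forall n, (q <= n)%N -> fin_step A n) ->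
  closed (range_mod (lin_iter A q) (null A d)) -> closed (ran A q).
Proof.
move=> bA fA cZ; have sN := subspace_null A d; have cN := closed_null (n := d) bA.
have bAq : bounded_op (lin_iter A q) := bounded_op_iter q bA.
have [C C0 solve] := open_mapping bAq sN cN cZ; have [K K0 AK] := bAq.
have sR := subspace_ran A q; have sZ := subspace_range_mod (lin_iter A q) sN.
have RZ x : ran A q x -> range_mod (lin_iter A q) (null A d) x.
  by move=> [u _ <-]; exists u; rewrite subrr; apply: subspace0.
apply/closed_adherent => x ax.
have [u Nu] : range_mod (lin_iter A q) (null A d) x.
  move/closed_adherent: cZ; apply=> e /ax [v Rv xv]; exists v => //; exact: RZ.
suff [Rv _] : (ran A q `&` null A d) (lin_iter A q u - x).
  rewrite -(subKr (lin_iter A q u) x); apply: subspaceB => //.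
  by exists u.
apply: ((closed_adherent _).1 (closed_ran_cap_null (j := d) bA fA)) => e e0.
have KC : 0 < 1 + K * C by rewrite ltr_pwDl ?mulr_ge0.
have [z Rz xz] := ax _ (divr_gt0 e0 KC).
have [|w wz Nw] := solve (x - z).
  have Zz := RZ _ Rz; have Zx : range_mod (lin_iter A q) (null A d) x by exists u.
  exact: subspaceB.
exists ((lin_iter A q u - x) - (lin_iter A q w - (x - z))).
  split; last exact: subspaceB.
  have -> : lin_iter A q u - x - (lin_iter A q w - (x - z)) = lin_iter A q (u - w) - z.
    rewrite (linearB (lin_iter A q)) !opprB !addrA [LHS](ACl (1*5*4*(3*2))) /=.
    by rewrite subrr addr0.
  by apply: subspaceB => //; exists (u - w).
rewrite subKr; apply: le_lt_trans (rnormB_le _ _) _.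
apply: le_lt_trans (lerD (AK _) (lexx _)) _.
rewrite ltr_pdivlMr // in xz; apply: le_lt_trans xz.
have := ler_wpM2l K0 wz; lra.
Qed.

End EssentialAscent.

(** * Topological uniform descent *)

Section TopologicalUniformDescent.
Context {R : realType} {X : completeNormedModType R[i]}.
Variables (A : {linear X -> X}) (d : nat).
Hypotheses (bA : bounded_op A) (tA : has_TUD A d).
Implicit Types (x y : X) (mu : R[i]).

(** The condition k_n = 0 means that R(A^n) ∩ N(A) does not shrink from n to n + 1. *)
Lemma TUD_kernel x n : (d <= n)%N -> A x = 0 -> ran A d x -> ran A n x.
Proof.
move=> + Ax Rx; elim: n => [|n IH]; first by rewrite leqn0 => /eqP <-.
rewrite leq_eqVlt => /predU1P[<- //|]; rewrite ltnS => dn.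
have sI : is_subspace (ran A n.+1 `&` null A 1).
  by apply: subspaceI; [apply: subspace_ran | apply: subspace_null].
by have [] := dim_quot0 sI (tA.1 n dn) (conj (IH dn) Ax).
Qed.

(** R(A^k) + N(A^d) is the preimage under A^d of R(A^(d+k)), and A^d is continuous
for the operator range topology. *)
Lemma TUD_closed k : closed (range_mod (lin_iter A k) (null A d)).
Proof.
apply/closed_adherent => x ax.
have [|u _ /= uE] := tA.2 (d + k)%N (leq_addr _ _) (iter d A x).
  split; first by exists x.
  move=> e /ax [v [u Nu] xv]; exists (iter d A v).
  have vE : iter (d + k) A u = iter d A v.
    by apply/subr0_eq; rewrite iterD -linearB.
  split; first by exists u.
  split; first by exists v.
  apply: le_lt_trans xv; apply: ge_inf; last by exists (x - v) => //; rewrite /= linearB.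
  by exists 0 => _ [w _ <-]; exact: rnorm_ge0.
by exists u; rewrite /null /lin_iter /= linearB /= -iterD uE subrr.
Qed.

Lemma TUD_kernel_mod x : null A d (A x) ->
  forall k, range_mod (lin_iter A k) (null A d) x.
Proof.
rewrite /null /= -iterSr /= => Ax k.
have [|u _ uE] := TUD_kernel (leq_addr k d) Ax; first by exists x.
by exists u; rewrite /null /lin_iter /= linearB /= -iterD uE subrr.
Qed.

(** For n beyond d the quotients N(A^(n+1)) / N(A^n) and N(A^(d+1)) / N(A^d) are copies
of R(A^n) ∩ N(A) and R(A^d) ∩ N(A), which coincide. *)
Lemma TUD_fin_step n : fin_step A n -> fin_step A d.
Proof.
have [nd|dn] := leqP n d; first exact: fin_step_le.
apply: (dim_quot_transfer (f := lin_iter A d) (g := lin_iter A n)) => //.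
- exact: subspace_null.
- move=> x /= Ax; have [|u _ uE] := TUD_kernel (ltnW dn) Ax; first by exists x.
  by exists u => //; rewrite /null /= uE.
Qed.

Lemma left_ess_drazin n : fin_step A n -> left_ess_drazin_invertible A.
Proof.
move=> An; have ex : exists n, `[< fin_step A n >] by exists n; apply/asboolP.
have [p /asboolP Ap pmin] := ex_minnP ex; exists p; split.
  by apply: ess_ascent_min => // m Am; apply: pmin; apply/asboolP.
apply: (@closed_ran _ _ _ _ d) => //; last exact: TUD_closed.
by move=> m pm; apply: fin_step_le Ap; apply: ltnW.
Qed.

(** A - mu is invertible on N(A^n), where A is nilpotent. *)
Lemma kernel_sub_ran mu n x : mu != 0 -> null A n x -> ran (sub_scalar A mu) 1 x.
Proof.
move=> mu0; elim: n x => [|n IH] x.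
  by rewrite /null /= => ->; exists 0 => //; rewrite linear0.
rewrite /null /= -iterS iterSr => /IH [w _ /= wE].
exists (mu^-1 *: (w - x)) => //.
rewrite /= linearZ /= linearB -wE subKr !scalerA mulVf // mulfV //.
by rewrite !scale1r subKr.
Qed.

(** The three clauses read the perturbation results for N = N(A^d) without the
quotient. For the range, N is contained in R(A - mu). For the kernel of
A - mu, A^d acts on it as mu^d, so it meets N trivially. For the converse,
the kernel of A modulo N is near elements g of the hyper-range with (A - mu) g in
N; on the hyper-range every power of A - mu is onto modulo N, so that A^d g lies
in N(A - mu) ∩ R((A - mu)^n), a copy of
N((A - mu)^(n+1)) / N((A - mu)^n). *)
Theorem punctured_neighbourhood : exists2 e : R, 0 < e &
  forall mu, mu != 0 -> rnorm mu < e ->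
   [/\ closed (ran (sub_scalar A mu) 1),
       fin_step A d -> (ldim (null (sub_scalar A mu) 1) < +oo)%E &
       forall n, fin_step (sub_scalar A mu) n -> fin_step A d].
Proof.
pose N := null A d.
have sN : is_subspace N := subspace_null A d; have cN : closed N := closed_null (n := d) bA.
have [C CP] := lifting_constant_ex bA sN cN TUD_closed; have [C0 _] := CP.
have C1 : 0 < C + 1 by rewrite ltr_wpDl.
exists (32^-1 / (C + 1)); first by rewrite divr_gt0 ?invr_gt0.
move=> mu mu0; rewrite ltr_pdivlMr // => mue; set B := sub_scalar A mu.
have Cmu : C * rnorm mu <= 32^-1.
  by apply: le_trans (ltW mue); rewrite mulrC ler_wpM2l ?rnorm_ge0 // lerDl.
have sV : is_subspace (null A d.+1) := subspace_null A d.+1.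
have NV : N `<=` null A d.+1 by move=> x Nx; rewrite /null /= Nx linear0.
have ABC x n : iter d A (iter n B x) = iter n B (iter d A x) := iter_sub_scalarC A mu d n x.
have BN x : N x -> N (B x).
  move=> Nx; change (iter d A (iter 1 B x) = 0).
  by rewrite ABC (_ : iter d A x = 0) ?linear0.
split.
- suff -> : ran B 1 = range_mod B N.
    exact: (closed_range_perturbed bA sN cN TUD_closed TUD_kernel_mod CP Cmu).
  apply/seteqP; split=> [_ [x _ <-]|y [x Nx]].
    by exists x; rewrite subrr; apply: subspace0.
  rewrite -(subKr (B x) y); apply: subspaceB; first exact: subspace_ran.
    by exists x.
  exact: kernel_sub_ran Nx.
- move=> fA; have sP : is_subspace (B @^-1` N) by apply: subspace_preimage.
  have fP : (dim_quot (B @^-1` N) N < +oo)%E.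
    apply: (finite_dim_near sN cN sP sV _ NV fA) => // x Nx.
    have [w Nw xw] := perturbed_near_kernel sN CP Cmu Nx; exists w => //.
    by rewrite /null /= -iterS iterSr.
  apply: (dim_quot_transfer (f := lin_iter A d) (g := lin_iter A d) _ _ _ _ fP) => //.
  + exact: subspace_null.
  + move=> x Bx; exists x => //=; rewrite /null /= in Bx.
    rewrite Bx; exact: subspace0.
  + move=> x Bx; have Ax : A x = mu *: x by apply/subr0_eq.
    have -> : lin_iter A d x = mu ^+ d *: x.
      rewrite /lin_iter /=; elim: d => [|k /= ->]; first by rewrite expr0 scale1r.
      by rewrite linearZ /= Ax scalerA exprSr.
    by move=> /eqP; rewrite scaler_eq0 expf_eq0 (negPf mu0) andbF => /eqP.
- move=> n fB; pose W := lin_iter A d @^-1` (ran B n `&` null B 1).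
  have sI := subspaceI (subspace_ran B n) (subspace_null B 1).
  have sW : is_subspace W := subspace_preimage (lin_iter A d) sI.
  have NW : N `<=` W.
    move=> x Nx; rewrite /W /preimage /= (_ : iter d A x = 0) //; exact: subspace0 sI.
  apply: (finite_dim_near sN cN sV sW NV NW).
    apply: (dim_quot_transfer (f := lin_iter A d) (g := lin_iter B n) sW _ _ _ fB) => //.
    by move=> x [[u _ uE] Bx]; exists u => //; rewrite /null /= uE.
  move=> x /= Ax.
  have [|g [Eg Ng] xg] := kernel_near_perturbed bA sN cN TUD_closed TUD_kernel_mod CP Cmu (x := x).
    by rewrite /N /null /= -iterSr.
  exists g => //.
  have [w Nw] : exists w, N (iter n B w - g).
    have : forall k y, hyper_range A N y -> exists2 w, hyper_range A N w & N (iter k B w - y).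
      elim=> [|k IH] y Ey; first by exists y => //; rewrite /= subrr; apply: subspace0.
      have [z [Ez _] Nz] := hyper_range_solve bA sN cN TUD_closed TUD_kernel_mod CP Cmu Ey.
      have [w Ew Nw] := IH z Ez; exists w => //.
      change (N (B (iter k B w) - y)).
      rewrite -(subrK (B z) (B (iter k B w))) -(linearB B) -addrA.
      by apply: subspaceD => //; exact: BN.
    by move=> /(_ n g Eg) [w _ Nw]; exists w.
  split.
    exists (iter d A w) => //; rewrite /= -ABC; apply/subr0_eq; rewrite -linearB.
    exact: Nw.
  by change (iter 1 B (iter d A g) = 0); rewrite -ABC.
Qed.

End TopologicalUniformDescent.

(** * Spectra and the equivalence *)

Section Spectra.
Context {R : realType} {X : completeNormedModType R[i]}.
Implicit Types (A B T : {linear X -> X}) (lambda mu : R[i]).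

Lemma usf_ext A B : (A : X -> X) = B -> upper_semi_fredholm A -> upper_semi_fredholm B.
Proof. by rewrite /upper_semi_fredholm /null /ran => ->. Qed.

Lemma led_ext A B : (A : X -> X) = B ->
  left_ess_drazin_invertible A -> left_ess_drazin_invertible B.
Proof. by rewrite /left_ess_drazin_invertible /ess_ascent /null /ran => ->. Qed.

Lemma sub_scalar_shift T lambda mu :
  (sub_scalar (sub_scalar T lambda) (mu - lambda) : X -> X) = sub_scalar T mu.
Proof.
by apply/funext => x; rewrite !sub_scalarE scalerBl opprB addrA subrK.
Qed.

Lemma sigma_led_usf T : sigma_led T `<=` sigma_usf T.
Proof. by move=> mu nled usf; apply: nled; apply: usf_led. Qed.

(** The complex plane has no isolated points. *)
Lemma interior_limit_point (S : set R[i]^o) lambda :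
  interior S lambda -> limit_point S lambda.
Proof.
move=> iS U nU; have /nbhs_rnorm [e e0 eP] : nbhs (lambda : R[i]^o) (S `&` U).
  exact: filterI.
pose h := ((e / 2)%:C)%C : R[i].
have h2 : rnorm h = e / 2 by rewrite rnormC gtr0_norm // divr_gt0.
have [|Sy Uy] := eP (lambda + h).
  rewrite opprD addrA subrr sub0r rnormN h2; lra.
exists (lambda + h); split=> //.
rewrite -subr_eq0 addrC addKr; apply/eqP => h0.
by move: h2; rewrite h0 rnorm0 => /esym/eqP; rewrite gt_eqF // divr_gt0.
Qed.

Lemma limit_pointS (S S' : set R[i]^o) : S `<=` S' -> limit_point S `<=` limit_point S'.
Proof.
move=> SS' lambda Sl U nU; have [y [yl Sy Uy]] := Sl U nU.
by exists y; split=> //; apply: SS'.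
Qed.

End Spectra.

Theorem theorem2p8 (R : realType) (X : completeNormedModType R[i])
    (Xinf : ldim [set: X] = +oo%E)
    (lambda : R[i]) (T : {linear X -> X}) (Tbdd : bounded_near T (nbhs (0 : X)))
    (d : nat) (TUD : has_TUD (sub_scalar T lambda) d) :
  [<-> ~ limit_point (sigma_usf T) lambda;
       ~ interior (sigma_usf T) lambda;
       ~ limit_point (sigma_led T) lambda;
       ~ interior (sigma_led T) lambda;
       (ess_ascent (sub_scalar T lambda) < +oo)%E;
       left_ess_drazin_invertible (sub_scalar T lambda)].
Proof.
set A := sub_scalar T lambda in TUD *.
have bA : bounded_op A := bounded_op_sub_scalar lambda (bounded_op_bounded_near Tbdd).
have [e e0 eP] := punctured_neighbourhood bA TUD.
have ascent_usf : (ess_ascent A < +oo)%E -> ~ limit_point (sigma_usf T) lambda.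
  move=> /ess_ascent_fin [n /(TUD_fin_step TUD) Ad].
  move=> /(_ (fun mu => rnorm (lambda - mu) < e)) [|mu [mul nusf mue]].
    by apply/nbhs_rnorm; exists e.
  apply: nusf; apply: usf_ext (sub_scalar_shift T lambda mu) _.
  rewrite rnormB in mue; have [||cB /(_ Ad) kB _] := eP (mu - lambda) => //.
  by rewrite subr_eq0.
have led_ascent : ~ interior (sigma_led T) lambda -> (ess_ascent A < +oo)%E.
  move=> nint; apply/ess_ascent_fin; apply: contrapT => nA; apply: nint.
  apply/nbhs_rnorm; exists e => // mu mue ledmu.
  have [ml|ml] := eqVneq mu lambda.
    by apply: nA; apply/ess_ascent_fin; apply: led_ess_ascent; rewrite /A -ml.
  have ledB := led_ext (esym (sub_scalar_shift T lambda mu)) ledmu.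
  have /ess_ascent_fin [n Bn] := led_ess_ascent ledB.
  rewrite rnormB in mue; have [||_ _ /(_ _ Bn) Ad] := eP (mu - lambda) => //.
    by rewrite subr_eq0.
  by apply: nA; exists d.
tfae.
- by move=> nl /interior_limit_point.
- move=> ni lp; apply: (ascent_usf _ (limit_pointS (@sigma_led_usf _ _ T) lp)).
  by apply: led_ascent => il; apply: ni; apply: interiorS il; apply: sigma_led_usf.
- by move=> nl /interior_limit_point.
- exact: led_ascent.
- by move=> /ess_ascent_fin [n An]; apply: left_ess_drazin TUD _ An.
- by move=> /led_ess_ascent/ascent_usf.
Qed.
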